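(* Let $A, A', A''$ be a BD triad on $V$ of diameter $d$. Let $\{\theta_i\}_{i=0}^d$, $\{\theta'_i\}_{i=0}^d$, $\{\theta''_i\}_{i=0}^d$ denote the first, second, and third eigenvalue sequences of $A, A', A''$ respectively. Suppose that $d \geq 2$. Then for $1 \leq i \leq d-1$ we have $$\frac{\theta_{i+1} - \theta_i}{\theta_i - \theta_{i-1}} = \frac{\theta'_{i+1} - \theta'_i}{\theta'_i - \theta'_{i-1}} = \frac{\theta''_{i+1} - \theta''_i}{\theta''_i - \theta''_{i-1}} = 1.$$
   Context: $\mathbb{K}$ is an algebraically closed field of characteristic zero and $V$ is a vector space over $\mathbb{K}$ with finite positive dimension. For linear transformations $X,Y:V\to V$, $[X,Y]:=XY-YX$. A bidiagonal triad (BD triad) on $V$ is an ordered triple of linear transformations $A,A',A'':V\to V$ such that: (i) Each of $A,A',A''$ is diagonalizable. (ii) There exist an ordering $\{V_i\}_{i=0}^d$ (resp. $\{V'_i\}_{i=0}^D$) (resp. $\{V''_i\}_{i=0}^\delta$) of the eigenspaces of $A$ (resp. $A'$) (resp. $A''$), each eigenspace listed exactly once, with $A'V_i\subseteq V_i+V_{i+1}$ and $A''V_i\subseteq V_i+V_{i+1}$ for $0\le i\le d$; $A''V'_i\subseteq V'_i+V'_{i+1}$ and $AV'_i\subseteq V'_i+V'_{i+1}$ for $0\le i\le D$; $AV''_i\subseteq V''_i+V''_{i+1}$ and $A'V''_i\subseteq V''_i+V''_{i+1}$ for $0\le i\le\delta$; where $V_{d+1}=V'_{D+1}=V''_{\delta+1}=0$.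 (iii) The following restrictions are bijections: $[A',A]^{d-2i}|_{V_i}:V_i\to V_{d-i}$ and $[A'',A]^{d-2i}|_{V_i}:V_i\to V_{d-i}$ for $0\le i\le d/2$; $[A'',A']^{D-2i}|_{V'_i}:V'_i\to V'_{D-i}$ and $[A,A']^{D-2i}|_{V'_i}:V'_i\to V'_{D-i}$ for $0\le i\le D/2$; $[A,A'']^{\delta-2i}|_{V''_i}:V''_i\to V''_{\delta-i}$ and $[A',A'']^{\delta-2i}|_{V''_i}:V''_i\to V''_{\delta-i}$ for $0\le i\le\delta/2$. It is known that $d=D=\delta$ for any BD triad; this common value $d$ is the diameter. The orderings in (ii) are uniquely determined by the BD triad and are called the standard orderings. Let $\theta_i$ (resp. $\theta'_i$) (resp. $\theta''_i$) be the eigenvalue of $A$ (resp. $A'$) (resp. $A''$) on $V_i$ (resp. $V'_i$) (resp. $V''_i$) for the standard orderings; $\{\theta_i\}_{i=0}^d$, $\{\theta'_i\}_{i=0}^d$, $\{\theta''_i\}_{i=0}^d$ are called the first, second, and third eigenvalue sequences of $A,A',A''$. *)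

(* Defs.v *)
From HB Require Import structures.
From mathcomp Require Import all_boot all_order all_algebra.

Set Implicit Arguments.
Unset Strict Implicit.
Unset Printing Implicit Defensive.

Import GRing.Theory.
Import passmx.

Local Open Scope ring_scope.

Section BidiagonalTriads.

Variables (K : fieldType) (V : vectType K).
Implicit Types (X Y A B C : 'End(V)) (U W : {vspace V}).

Definition lfun_comm X Y : 'End(V) := (X \o Y)%VF - (Y \o X)%VF.

Definition lfun_diagonalizable X : Prop :=
  exists2 b : seq V, basis_of {:V} b
                   & forall v, v \in b -> exists a : K, X v = a *: v.

Definition is_eigenspace X U : Prop :=
  exists2 a : K, leigenvalue X a & U = leigenspace X a.

Definition eigenspace_ordering X (s : seq {vspace V}) : Prop :=
  uniq s /\ (forall U, U \in s <-> is_eigenspace X U).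

(* The default value 0%VS of nth encodes the convention V_{n+1} = 0. *)
Definition raises_bidiagonally X n (s : n.+1.-tuple {vspace V}) : Prop :=
  forall i : nat, (i <= n)%N ->
    (X @: nth 0%VS s i <= nth 0%VS s i + nth 0%VS s i.+1)%VS.

Definition restricts_to_bijection (f : V -> V) U W : Prop :=
  [/\ {in U, forall v, f v \in W},
      {in U &, injective f}
    & {in W, forall w, exists2 v, v \in U & f v = w}].

Definition iterates_bijectively X n (s : n.+1.-tuple {vspace V}) : Prop :=
  forall i : nat, (i.*2 <= n)%N ->
    restricts_to_bijection (iter (n - i.*2) X)
                           (nth 0%VS s i) (nth 0%VS s (n - i)).

(* Conditions (ii) and (iii) in the definition of a bidiagonal triad, as they
   concern one member A and an ordering s of its eigenspaces; B and C are the
   other two members.  These conditions are symmetric in B and C. *)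
Definition standard_ordering A B C n (s : n.+1.-tuple {vspace V}) : Prop :=
  [/\ eigenspace_ordering A s,
      raises_bidiagonally B s /\ raises_bidiagonally C s
    & iterates_bijectively (lfun_comm B A) s /\
      iterates_bijectively (lfun_comm C A) s].

Definition BD_triad A A' A'' : Prop :=
  [/\ lfun_diagonalizable A, lfun_diagonalizable A', lfun_diagonalizable A''
    & exists (d D delta : nat) (s : d.+1.-tuple {vspace V})
             (s' : D.+1.-tuple {vspace V}) (s'' : delta.+1.-tuple {vspace V}),
      [/\ standard_ordering A A' A'' s,
          standard_ordering A' A'' A s'
        & standard_ordering A'' A A' s'']].

Definition eigenvalue_sequence A B C n (th : n.+1.-tuple K) : Prop :=
  exists2 s : n.+1.-tuple {vspace V}, standard_ordering A B C s
    & forall i : 'I_n.+1,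
        leigenvalue A (tnth th i) /\ tnth s i = leigenspace A (tnth th i).

End BidiagonalTriads.

(* Main.v *)
(** The ratios for two cyclically consecutive members of the triad are inverse to
    each other: with [X = BA - AB], both eigenspace orderings [V_i] of [A] and [W_i]
    of [B] satisfy [X V_i <= V_(i+1)] and [X W_i <= W_(i+1)].  Pick [v] in [V_0]
    with [X^d v != 0], and let [w] be its component in [W_1].  Computing the
    [V_d]-component of [X^(d-1-i) B X^i v] once along the [V_j] and once along the
    [W_j] shows that
    [(th_(i+1) - th_i) (ph_(i+1) - ph_i) X^(d-1) w = - X^d v] for all [i < d], so
    the product of the gaps does not depend on [i].  Going once around the triad,
    the common ratio [r] satisfies [r^2 = 1], and [r = -1] would force
    [th_(i+1) = th_(i-1)]. *)

From HB Require Import structures.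
Require Import Defs.
From mathcomp Require Import all_boot all_order all_algebra.
From mathcomp Require Import ring.

Import GRing.Theory passmx.
Local Open Scope ring_scope.

(** * Powers of a map that raises a sequence of subspaces *)

Section IteratesOfEndomorphisms.

Context {K : fieldType} {V : vectType K}.
Implicit Types (X : 'End(V)) (v w : V).

Fact iter_lfun_linear X k : linear (iter k X).
Proof. by elim: k => [|k IHk] a v w //=; rewrite IHk linearP. Qed.

HB.instance Definition _ X k :=
  GRing.isLinear.Build K V V _ (iter k X) (iter_lfun_linear X k).

Lemma iter_raise X (U : nat -> {vspace V}) (k i : nat) v :
  (forall j u, u \in U j -> X u \in U j.+1) -> v \in U i -> iter k X v \in U (k + i)%N.
Proof. by move=> XU Uv; elim: k => //= k IHk; apply: XU. Qed.

End IteratesOfEndomorphisms.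

(** * Eigenspace decompositions and the raising action of the commutator *)

Section EigenspaceOrderings.

Context {K : fieldType} {V : vectType K}.
Implicit Types (A B X : 'End(V)) (v w : V).

Lemma memv_leigenspace A a v : (v \in leigenspace A a) = (A v == a *: v).
Proof.
by rewrite memv_ker add_lfunE opp_lfunE scale_lfunE id_lfunE subr_eq0.
Qed.

Lemma leigenspace_cap_eq0 A a b v :
  a != b -> v \in leigenspace A a -> v \in leigenspace A b -> v = 0.
Proof.
rewrite !memv_leigenspace => neq_ab /eqP-> /eqP/eqP.
by rewrite -subr_eq0 -scalerBl scaler_eq0 subr_eq0 (negPf neq_ab) => /eqP.
Qed.

(** A vector of an eigenbasis is nonzero, so its eigenspace must occur in [s]. *)
Lemma eigenspace_ordering_sum A n (s : n.+1.-tuple {vspace V}) :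
    lfun_diagonalizable A -> eigenspace_ordering A s ->
  forall v, exists2 vs : 'I_n.+1 -> V,
    forall i, vs i \in nth 0%VS s i & v = \sum_i vs i.
Proof.
move=> [b bV Ab] [_ sE] v.
have: v \in (\sum_(i < n.+1) nth 0%VS s i)%VS.
  suff: ({:V} <= \sum_(i < n.+1) nth 0%VS s i)%VS by move/subvP; apply; rewrite memvf.
  rewrite -(span_basis bV); apply/span_subvP => u bu.
  have [a Au] := Ab u bu.
  have u_neq0 : u != 0 := free_not0 (basis_free bV) bu.
  have uE: u \in leigenspace A a by rewrite memv_leigenspace Au.
  have: leigenspace A a \in tval s.
    apply/sE; exists a => //; apply: contraNneq u_neq0 => E0.
    by rewrite -memv0 -E0.
  case/(nthP 0%VS) => i; rewrite size_tuple => lt_in Ei.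
  by move: uE; rewrite -Ei; apply/subvP/(sumv_sup (Ordinal lt_in)).
by case/memv_sumP => vs vsP ->; exists vs => // i; apply: vsP.
Qed.

Section Tuples.

Context {A : 'End(V)} {n : nat} {s : n.+1.-tuple {vspace V}} {th : n.+1.-tuple K}.
Hypothesis sE : forall i, tnth s i = leigenspace A (tnth th i).

Lemma nth_leigenspace i : (i <= n)%N -> nth 0%VS s i = leigenspace A th`_i.
Proof.
rewrite -ltnS => lt_in; have := sE (Ordinal lt_in).
by rewrite !(tnth_nth 0) !(tnth_nth 0%VS).
Qed.

Lemma nth_leigen i v : v \in nth 0%VS s i -> A v = th`_i *: v.
Proof.
have [le_in | lt_ni] := leqP i n.
  by rewrite nth_leigenspace // memv_leigenspace => /eqP.
by rewrite nth_default ?size_tuple // memv0 => /eqP->; rewrite linear0 scaler0.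
Qed.

Lemma nth_eigenvalue_eq i j :
  uniq s -> (i <= n)%N -> (j <= n)%N -> (th`_i == th`_j) = (i == j).
Proof.
move=> Us le_in le_jn; apply/eqP/eqP => [eq_th | -> //].
apply/eqP; rewrite -(nth_uniq 0%VS _ _ Us) ?size_tuple //.
by rewrite !nth_leigenspace // eq_th.
Qed.

(** The [p]-terms of [B A v] and [A B v] cancel, which leaves only a multiple of [q]. At [i = n] the
    next space is 0, so [q = 0] and the default eigenvalue past the end is harmless. *)
Lemma raises_split B i v : raises_bidiagonally B s -> v \in nth 0%VS s i ->
  exists p q, [/\ p \in nth 0%VS s i, q \in nth 0%VS s i.+1, B v = p + q
                & lfun_comm B A v = (th`_i - th`_i.+1) *: q].
Proof.
move=> Bs s_v; have [le_in | lt_ni] := leqP i n; last first.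
  move: s_v; rewrite nth_default ?size_tuple // memv0 => /eqP->.
  by exists 0, 0; rewrite !linear0 addr0 !mem0v.
have /memv_addP[p s_p [q s_q Bv]] := subvP (Bs i le_in) _ (memv_img B s_v).
exists p, q; split=> //.
rewrite /lfun_comm add_lfunE opp_lfunE !comp_lfunE (nth_leigen _ _ s_v) linearZ /= Bv.
rewrite [A _]linearD /= (nth_leigen _ _ s_p) (nth_leigen _ _ s_q) scalerDr scalerBl.
by rewrite opprD addrACA subrr add0r.
Qed.

Lemma lfun_comm_raise B : raises_bidiagonally B s ->
  forall i v, v \in nth 0%VS s i -> lfun_comm B A v \in nth 0%VS s i.+1.
Proof.
by move=> Bs i v /(raises_split _ _ _ Bs)[p [q [_ s_q _ ->]]]; rewrite memvZ.
Qed.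

End Tuples.

(** All components of [v] but the first are pushed past index [n], where the space is 0. *)
Lemma iter_raise_last X n (s : n.+1.-tuple {vspace V}) :
    (forall v, exists2 vs : 'I_n.+1 -> V,
       forall i, vs i \in nth 0%VS s i & v = \sum_i vs i) ->
    (forall i v, v \in nth 0%VS s i -> X v \in nth 0%VS s i.+1) ->
  forall v, iter n X v \in nth 0%VS s n.
Proof.
move=> sumV Xs v; have [vs s_vs ->] := sumV v.
rewrite linear_sum big_ord_recl /= big1 ?addr0 => [|i _].
  by have /= := iter_raise X _ n 0 _ Xs (s_vs ord0); rewrite addn0.
have := iter_raise X _ n _ _ Xs (s_vs (lift ord0 i)).
by rewrite nth_default ?memv0 => [/eqP | ] //; rewrite size_tuple lift0 addnS ltnS leq_addr.
Qed.

End EigenspaceOrderings.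

Lemma lfun_commC {K : fieldType} {V : vectType K} (A B : 'End(V)) :
  lfun_comm A B = - lfun_comm B A.
Proof. by rewrite /lfun_comm opprB. Qed.

(** * Products of eigenvalue gaps of two consecutive members *)

Section EigenvalueGaps.

Context {K : fieldType} {V : vectType K}.

Lemma eigenvalue_sequence_eq {A B C : 'End(V)} {n} {th : n.+1.-tuple K} i j :
  eigenvalue_sequence A B C th -> (i <= n)%N -> (j <= n)%N ->
  (th`_i == th`_j) = (i == j).
Proof.
by case=> s [[Us _] _ _] sE; apply: (nth_eigenvalue_eq (fun i => (sE i).2)) Us.
Qed.

Lemma eigenvalue_gap_product {A B C : 'End(V)} {n} {th ph : n.+1.-tuple K} :
    lfun_diagonalizable A -> lfun_diagonalizable B ->
    eigenvalue_sequence A B C th -> eigenvalue_sequence B C A ph ->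
  forall i j, (i < n)%N -> (j < n)%N ->
    (th`_i.+1 - th`_i) * (ph`_i.+1 - ph`_i) = (th`_j.+1 - th`_j) * (ph`_j.+1 - ph`_j).
Proof.
(* A diameter 0 leaves no gap; otherwise [m] is the exponent [d - 1]. *)
case: n th ph => [|m] th ph // diagA diagB thP phP.
have neq_th := fun i j => eigenvalue_sequence_eq i j thP.
case: thP => s [ordA [Bs _] [itX _]] sE.
case: phP => t [ordB [_ At] [_ itY]] tE.
have {}sE i := (sE i).2.
have th0P: leigenspace A th`_0 != 0%VS.
  case: ordA => _ /(_ (tnth s ord0)); rewrite mem_tnth => -[/(_ isT) [a Ea sa] _].
  by rewrite -(nth_leigenspace sE) // -[nth _ _ _](tnth_nth 0%VS s ord0) sa.
have {}tE i := (tE i).2.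
set X := lfun_comm B A in itX.
have YX: lfun_comm A B = - X := lfun_commC A B.
have Xs : forall i v, v \in nth 0%VS s i -> X v \in nth 0%VS s i.+1.
  exact: (lfun_comm_raise sE _ Bs).
have Xt i v : v \in nth 0%VS t i -> X v \in nth 0%VS t i.+1.
  by move/(lfun_comm_raise tE _ At); rewrite YX opp_lfunE memvN.
have sumA := eigenspace_ordering_sum _ _ _ diagA ordA.
have sumB := eigenspace_ordering_sum _ _ _ diagB ordB.
(* By (iii), the last eigenspace of [B] is the image of the first under the [d]-th power of [[A, B]
   = - X], and such a power sends every vector into the last eigenspace of [A]. *)
have sub_ts w : w \in nth 0%VS t m.+1 -> w \in nth 0%VS s m.+1.
  have [_ _ surj] := itY 0 isT; rewrite subn0 in surj => /surj[u _ <-].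
  apply: iter_raise_last sumA _ u => i v s_v.
  by rewrite YX opp_lfunE memvN Xs.
have [_ injX _] := itX 0 isT; rewrite subn0 /= in injX.
set v0 := vpick (nth 0%VS s 0).
have s_v0 : v0 \in nth 0%VS s 0 by apply: memv_pick.
have v0_neq0 : v0 != 0 by rewrite vpick0 (nth_leigenspace sE).
have Xv0_neq0 : iter m.+1 X v0 != 0.
  apply: contraNneq v0_neq0 => Xv0; apply/eqP/injX; rewrite ?mem0v //=.
  by rewrite [LHS]Xv0 !linear0.
have [w t_w v0E] := sumB v0.
have Xm i v : v \in nth 0%VS t i.+2 -> iter m X v = 0.
  move/(iter_raise X _ m _ _ Xt); rewrite nth_default ?memv0 => [/eqP//|].
  by rewrite size_tuple !addnS !ltnS leq_addr.
pose w1 := w (lift ord0 ord0).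
have Xmv0 : iter m X v0 = iter m X (w ord0) + iter m X w1.
  rewrite v0E linear_sum !big_ord_recl /= big1 ?addr0 // => i _.
  exact: (Xm i).
have gap i : (i < m.+1)%N ->
    iter m.+1 X v0 = - ((th`_i.+1 - th`_i) * (ph`_i.+1 - ph`_i)) *: iter m X w1.
  rewrite ltnS => le_im.
  have s_iv : iter i X v0 \in nth 0%VS s i.
    by have := iter_raise X _ i _ _ Xs s_v0; rewrite addn0.
  have [p [q [s_p s_q Bv Xv]]] := raises_split sE _ _ _ Bs s_iv.
  (* Expand [v0] along the eigenspaces of [B]: [B] scales the [j]-th term by the eigenvalue of index
     [i + j], and [X^m] kills the terms with [j >= 2]. *)
  have XBX : iter (m - i) X (B (iter i X v0)) =
      ph`_i *: iter m X v0 + (ph`_i.+1 - ph`_i) *: iter m X w1.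
    have term (j : 'I_m.+2) :
        iter (m - i) X (B (iter i X (w j))) = ph`_(i + j)%N *: iter m X (w j).
      have := iter_raise X _ i _ _ Xt (t_w j) => /(nth_leigen tE) ->.
      by rewrite linearZ /= -iterD subnK.
    rewrite {1}v0E !linear_sum /= (eq_bigr _ (fun j _ => term j)).
    rewrite !big_ord_recl /= big1 ?addr0 => [|j _]; last by rewrite (Xm j) ?scaler0.
    rewrite Xmv0 scalerDr -addrA -scalerDl [ph`_i + _]addrC subrK.
    by rewrite addn0 addn1.
  (* By [XBX] and [B (X^i v0) = p + q], the difference of the two sides lies in the [A]-eigenspace
     of index [m]; by [sub_ts] it also lies in the one of index [m.+1]. *)
  have Xq : iter (m - i) X q = (ph`_i.+1 - ph`_i) *: iter m X w1.
    apply/eqP; rewrite -subr_eq0; apply/eqP.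
    apply: (leigenspace_cap_eq0 A th`_m th`_m.+1); first by rewrite neq_th // ltn_eqF.
      rewrite -(nth_leigenspace sE) //.
      have -> : iter (m - i) X q - (ph`_i.+1 - ph`_i) *: iter m X w1 =
          ph`_i *: iter m X v0 - iter (m - i) X p.
        apply/eqP; rewrite subr_eq addrAC -XBX Bv linearD /=.
        by rewrite addrAC subrr add0r.
      rewrite memvB ?memvZ //.
        by have := iter_raise X _ m _ _ Xs s_v0; rewrite addn0.
      by have := iter_raise X _ (m - i) _ _ Xs s_p; rewrite subnK.
    rewrite -(nth_leigenspace sE) // memvB //.
      by have := iter_raise X _ (m - i) _ _ Xs s_q; rewrite addnS subnK.
    apply/memvZ/sub_ts.
    by have := iter_raise X _ m _ _ Xt (t_w (lift ord0 ord0)); rewrite addn1.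
  have -> : iter m.+1 X v0 = iter (m - i) X (X (iter i X v0)).
    by rewrite -iterS -iterD addnS subnK.
  by rewrite Xv linearZ /= Xq scalerA -mulNr opprB.
move=> i j lt_i lt_j; apply/eqP; rewrite -subr_eq0 -oppr_eq0.
(* Since [X^d v0] is a nonzero multiple of [X^m w1], the coefficients given by [gap] at [i] and [j]
   can be compared. *)
have w1_neq0 : iter m X w1 != 0.
  by apply: contraNneq Xv0_neq0 => w0; rewrite (gap i lt_i) w0 scaler0.
have := gap j lt_j; rewrite (gap i lt_i) => /eqP.
rewrite -subr_eq0 -scalerBl scaler_eq0 (negPf w1_neq0) orbF.
by rewrite opprK opprD opprK.
Qed.

End EigenvalueGaps.

(** * Comparison of the ratios around the triad *)

Lemma cyclic_inverse_ratios {K : fieldType} {a a' b b' c c' : K} :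
    a * b = a' * b' -> b * c = b' * c' -> c * a = c' * a' ->
    a != 0 -> b != 0 -> c != 0 -> a + a' != 0 ->
  [/\ a / a' = b / b', b / b' = c / c' & c / c' = 1].
Proof.
move=> Eab Ebc Eca a0 b0 c0 aa'0.
have Ea : a = a'.
  apply/eqP; rewrite -subr_eq0.
  (* Here [a^2 b c = (a b)(c a) = (a' b')(c' a') = a'^2 b c]. *)
  have : (a - a') * ((a + a') * (b * c)) = 0.
    transitivity ((a * b) * (c * a) - a' * a' * (b * c)); first by ring.
    by rewrite Eab Eca Ebc; ring.
  by move/eqP; rewrite !mulf_eq0 (negPf aa'0) (negPf b0) (negPf c0) !orbF.
have Eb : b = b' by apply: (mulfI a0); rewrite Eab Ea.
have Ec : c = c' by apply: (mulfI b0); rewrite Ebc Eb.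
by rewrite -Ea -Eb -Ec !divff.
Qed.

Theorem theorem4p1 (K : closedFieldType) (charK0 : [pchar K] =i pred0)
    (V : vectType K) (dimV : (0 < \dim {:V})%N)
    (A A' A'' : 'End(V)) (d : nat) (th th' th'' : d.+1.-tuple K) :
  BD_triad A A' A'' ->
  eigenvalue_sequence A A' A'' th ->
  eigenvalue_sequence A' A'' A th' ->
  eigenvalue_sequence A'' A A' th'' ->
  (2 <= d)%N ->
  forall i : nat, (1 <= i <= d - 1)%N ->
    [/\ (th`_i.+1 - th`_i) / (th`_i - th`_i.-1)
          = (th'`_i.+1 - th'`_i) / (th'`_i - th'`_i.-1),
        (th'`_i.+1 - th'`_i) / (th'`_i - th'`_i.-1)
          = (th''`_i.+1 - th''`_i) / (th''`_i - th''`_i.-1)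
      & (th''`_i.+1 - th''`_i) / (th''`_i - th''`_i.-1) = 1].
Proof.
move=> [diagA diagA' diagA'' _] thP thP' thP'' le2d [//|i] /= le_id.
have {le_id} lt_id : (i.+1 < d)%N by move: le_id; rewrite subn1 -ltnS prednK // ltnW.
have lt_id' := ltnW lt_id.
have gap_neq0 (B B' B'' : 'End(V)) (eta : d.+1.-tuple K) k :
    eigenvalue_sequence B B' B'' eta -> (k < d)%N -> eta`_k.+1 - eta`_k != 0.
  move=> etaP lt_kd.
  by rewrite subr_eq0 (eigenvalue_sequence_eq _ _ etaP) ?gtn_eqF // ltnW.
apply: cyclic_inverse_ratios.
- exact: eigenvalue_gap_product diagA diagA' thP thP' _ _ _ _.
- exact: eigenvalue_gap_product diagA' diagA'' thP' thP'' _ _ _ _.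
- exact: eigenvalue_gap_product diagA'' diagA thP'' thP _ _ _ _.
- exact: gap_neq0 thP _.
- exact: gap_neq0 thP' _.
- exact: gap_neq0 thP'' _.
(* Two consecutive gaps add up to a difference of eigenvalues whose indices differ by 2, which is
   nonzero. *)
by rewrite subrKA subr_eq0 (eigenvalue_sequence_eq _ _ thP) // ?gtn_eqF // ltnW.
Qed.
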